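(* Let $w^1,\dots,w^d\in S_n$ with $\sum_{i=1}^d\ell(w^i)=\binom n2$, let $E^1_\bullet,\dots,E^d_\bullet$ be generally chosen flags in $\mathcal{F}\ell_n$, and let $X=X_{w^1}(E^1_\bullet)\cap\cdots\cap X_{w^d}(E^d_\bullet)$. Let $P_n$ be the array in $[n]^d$ determined by $w^1,\dots,w^d$ via the recurrence given in the context. If $P_n\ne T_{n,d}$, where $T_{n,d}$ is the transverse permutation array, then $X$ is the empty set.
   Context: Work over an arbitrary field $K$. $\mathcal{F}\ell_n$ is the variety of complete flags $F_\bullet=\{0=F_0\subset F_1\subset\cdots\subset F_n=K^n\}$, $\dim F_i=i$. ''Generally chosen'' means that the statement holds for all $(E^1_\bullet,\dots,E^d_\bullet)$ in a suitable dense Zariski-open subset of $\mathcal{F}\ell_n^d$. Schubert varieties. To $w\in S_n$ associate the $n\times n$ matrix with a $1$ in row $w(i)$ of column $n-i+1$ for $1\le i\le n$ and $0$ elsewhere (a nonstandard labelling); $w[i,j]$ is its upper-left submatrix formed by rows $1,\dots,i$ and columns $1,\dots,j$. $\ell(w)$ is the number of inversions of $w$. $X_w(F_\bullet)=\{G_\bullet\in\mathcal{F}\ell_n:\dim(F_i\cap G_j)\ge\mathrm{rank}\,w[i,j]\ \forall\,1\le i,j\le n\}$. Permutation arrays. Let $[n]=\{1,\dots,n\}$. For $x,y\in[n]^m$ write $x\preceq y$ if $x_i\le y_i$ for all $i$; $\bigvee R$ is the coordinatewise maximum of a set $R$. A dot array is a subset $P\subset[n]^m$; $P[y]=\{x\in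 P: x\preceq y\}$. Put $\mathrm{rk}_jP=\#\{k\in[n]:\exists x\in P,\ x_j=k\}$. $P$ is rankable of rank $r$, written $\mathrm{rk}\,P=r$, if $\mathrm{rk}_jP=r$ for all $j$; it is totally rankable if every $P[y]$ is rankable. A position $x$ is redundant in $P$ if there is $R\subset P$ with $x=\bigvee R$, $\#R>1$, and every $y\in R$ has some coordinate $y_i=x_i$. A permutation array in $[n]^m$ is a totally rankable dot array of rank $n$ no element of which is redundant; it is determined by its rank table $x\mapsto\mathrm{rk}\,P[x]$. The transverse permutation array is $T_{n,d}=\{(x_1,\dots,x_d)\in[n]^d:\sum x_i=(d-1)n+1\}$; its rank table is $\mathrm{rk}(T_{n,d}[x])=\max(0,\,n-\sum_{i=1}^d(n-x_i))$. The recurrence. Define a table of integers $r(x_1,\dots,x_d;j)$ for $x\in[n]^d$, $0\le j\le n$, as follows. Let $s_1<\dots<s_k$ be the indices $s$ with $x_s\le n-1$; the value depends only on the pairs $(s_i,x_{s_i})$ and $j$, and is written $r(x_{s_1},\dots,x_{s_k};j)$. Put $r(\cdot;0)=0$. For $k=0$, $r=j$. For $k=1$, $r(x_{s};j)=\mathrm{rank}\,w^{s}[x_s,j]$. For $k\ge2$ and $j\ge1$, $$r(x_{s_1},\dots,x_{s_k};j)=\max\{\,r(x_{s_1};j)+r(x_{s_2},\dots,x_{s_k};j)-j,\ \ r(x_{s_1},\dots,x_{s_k};j-1)\,\}.$$ The permutation array $P\subset[n]^{d+1}$ associated with the Schubert problem is the one with rank table $\mathrm{rk}\,P[(x_1,\dots,x_d,j)]=r(x_1,\dots,x_d;j)$,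 and $P_n\subset[n]^d$ is the permutation array with rank table $\mathrm{rk}\,P_n[x]=r(x_1,\dots,x_d;n)$. Thus $P_n\neq T_{n,d}$ means that $r(x;n)\neq\mathrm{rk}(T_{n,d}[x])$ for some $x\in[n]^d$. *)

(* Defs.v *)
From HB Require Import structures.
From mathcomp Require Import all_boot all_order all_algebra all_fingroup.
From mathcomp Require Import mpoly.

Set Implicit Arguments.
Unset Strict Implicit.
Unset Printing Implicit Defensive.

Import GRing.Theory Num.Theory.
Local Open Scope ring_scope.

Definition inversions n (w : 'S_n) : nat :=
  #|[set p : 'I_n * 'I_n | (p.1 < p.2)%N && (w p.2 < w p.1)%N]|.

(* In 1-based terms the entry 1 of column n - i + 1 sits in row w(i);
   [rev_ord] is i |-> n - i + 1. *)
Definition schubert_mx n (w : 'S_n) : 'M[rat]_n :=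
  \matrix_(a, c) (a == w (rev_ord c))%:R.

(* For i, j <= n, multiplying by the two partial identities extracts the
   submatrix on the first i rows and the first j columns. *)
Definition corner_rank n (w : 'S_n) (i j : nat) : nat :=
  \rank ((pid_mx i : 'M_(i, n)) *m schubert_mx w *m (pid_mx j : 'M_(n, j))).

(* A position of [n]^m is a finite function to 'I_n; the ordinal [x i] encodes
   the 1-based coordinate [(x i).+1]. *)

Notation position n m := {ffun 'I_m -> 'I_n}.
Notation dot_array n m := {set {ffun 'I_m -> 'I_n}}.

Definition pos_le n m (x y : position n m) : bool :=
  [forall i, (x i <= y i)%N].

Definition principal n m (P : dot_array n m) (y : position n m) :
    dot_array n m :=
  [set x in P | pos_le x y].

Definition rk_coord n m (P : dot_array n m) (j : 'I_m) : nat :=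
  #|[set k : 'I_n | [exists x in P, x j == k]]|.

Definition has_rank n m (P : dot_array n m) (r : nat) : Prop :=
  forall j, rk_coord P j = r.

Definition totally_rankable n m (P : dot_array n m) : Prop :=
  forall y, exists r, has_rank (principal P y) r.

Definition is_join n m (R : dot_array n m) (x : position n m) : Prop :=
  forall i, (x i : nat) = (\max_(y in R) y i)%N.

Definition redundant n m (P : dot_array n m) (x : position n m) : Prop :=
  exists R : dot_array n m,
    [/\ R \subset P, is_join R x, (1 < #|R|)%N
      & forall y, y \in R -> exists i, y i = x i].

Definition permutation_array n m (P : dot_array n m) : Prop :=
  [/\ totally_rankable P, has_rank P n
    & forall x, x \in P -> ~ redundant P x].

Definition has_rank_table n m (P : dot_array n m) (t : position n m -> int) :
    Prop :=
  forall x, exists2 r : nat, has_rank (principal P x) r & t x = r%:Z.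

(* The equation sum_i x_i = (m - 1) n + 1, written without subtraction. *)
Definition transverse_array n m : dot_array n m :=
  [set x : position n m | ((\sum_i (x i).+1) + n == m * n + 1)%N].

Section Recurrence.
Variables (n d : nat) (w : 'I_d -> 'S_n) (x : position n d).

(* The value r(x_{s_1}, ..., x_{s_k}; j) for the index list [s_1; ...; s_k]. *)
Fixpoint rec_value (l : seq 'I_d) : nat -> int :=
  match l with
  | [::] => fun j => j%:Z
  | [:: s] => fun j => (corner_rank (w s) (x s).+1 j)%:Z
  | s :: l' =>
      fix value_at (j : nat) : int :=
        if j is j'.+1 then
          Num.max ((corner_rank (w s) (x s).+1 j)%:Z + rec_value l' j - j%:Z)
                  (value_at j')
        else 0
  end.

Definition rec_table (j : nat) : int :=
  rec_value [seq s <- enum 'I_d | ((x s).+1 < n)%N] j.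

End Recurrence.

(* A permutation array is determined by its rank table, so at most one array P
   satisfies this. *)
Definition is_schubert_array n d (w : 'I_d -> 'S_n) (P : dot_array n d) :
    Prop :=
  permutation_array P /\ has_rank_table P (fun x => rec_table w x n).

Record flag (L : fieldType) (n : nat) := Flag {
  flag_space :> 'I_n.+1 -> {vspace 'rV[L]_n};
  flag_dim : forall i, \dim (flag_space i) = i;
  flag_sub : forall i j : 'I_n.+1,
    (i <= j)%N -> (flag_space i <= flag_space j)%VS
}.

(* The conditions with i = 0 or j = 0 hold trivially. *)
Definition schubert_variety (L : fieldType) n (w : 'S_n) (F G : flag L n) :
    Prop :=
  forall i j : 'I_n.+1, (corner_rank w i j <= \dim (F i :&: G j)%VS)%N.

Definition schubert_intersection (L : fieldType) n d (w : 'I_d -> 'S_n)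
    (E : 'I_d -> flag L n) (G : flag L n) : Prop :=
  forall s, schubert_variety (w s) (E s) G.

(* K may be finite, so subsets of the d-fold product of the flag
   variety cannot be described by their
   K-points alone: a subset is given by its L-points for all extension fields
   L of K.  The variety of flags is the quotient of GL_n by a Borel subgroup,
   via g |-> (spans of the first i rows of g)_i.  This quotient map is open and
   surjective on L-points for every L, so a subset of the product is open iff
   its preimage in (GL_n)^d is, i.e. iff this preimage is the locus where some
   member of a set of polynomials over K in the matrix entries is nonzero. *)

Definition matrix_poly (K : fieldType) (n d : nat) :=
  {mpoly K[#|{: 'I_d * 'I_n * 'I_n}|]}.

Definition eval_matrices (K L : fieldType) (iota : {rmorphism K -> L}) n d
    (g : 'I_d -> 'M[L]_n) (p : matrix_poly K n d) : L :=
  (map_mpoly iota p).@[fun k => let: (s, a, b) := enum_val k in g s a b].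

Definition represents (L : fieldType) n (g : 'M[L]_n) (F : flag L n) : Prop :=
  g \in unitmx /\
  forall i, F i = <<[seq row a g | a : 'I_n <- enum 'I_n & (a < i)%N]>>%VS.

Definition flag_subset (K : fieldType) (n d : nat) : Type :=
  forall (L : fieldType) (iota : {rmorphism K -> L}),
    ('I_d -> flag L n) -> Prop.

Definition zariski_open (K : fieldType) n d (U : flag_subset K n d) : Prop :=
  exists S : matrix_poly K n d -> Prop,
  forall (L : fieldType) (iota : {rmorphism K -> L})
         (E : 'I_d -> flag L n) (g : 'I_d -> 'M[L]_n),
    (forall s, represents (g s) (E s)) ->
    (U L iota E <-> exists2 p, S p & eval_matrices iota g p != 0).

Definition zariski_dense (K : fieldType) n d (U : flag_subset K n d) : Prop :=
  forall V : flag_subset K n d, zariski_open V ->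
    (exists L iota E, V L iota E) ->
    exists L iota E, U L iota E /\ V L iota E.

Definition for_general_flags (K : fieldType) n d (Q : flag_subset K n d) :
    Prop :=
  exists U : flag_subset K n d,
    [/\ zariski_open U, zariski_dense U
      & forall L iota E, U L iota E -> Q L iota E].

(* Main.v *)
Require Import Defs.
From HB Require Import structures.
From mathcomp Require Import all_boot all_order all_algebra all_fingroup.
From mathcomp Require Import mpoly.
From mathcomp Require Import zify.

Set Implicit Arguments.
Unset Strict Implicit.
Unset Printing Implicit Defensive.

Import Order.TTheory GRing.Theory Num.Theory.
Local Open Scope ring_scope.

(** Dimensions alone decide the matter. Subspaces of dimensions [a] and [c] of
    [G_j] meet in dimension at least [a + c - j], so the
    two branches of the recurrence (transversality inside [G_j], monotonicity
    in [j]) are lower bounds that hold for every choice of flags: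
    each [G] in the intersection of the Schubert varieties satisfies
    [r(x; n) <= dim (E^1_(x_1) :&: ... :&: E^d_(x_d))] for all positions [x]
    ([rec_table_le_dim]).

    On the other hand [r(x; n) >= max(0, n - sum_s (n - x_s))] by the same
    recurrence ([rec_table_ge]), and the right-hand side is the rank table of
    the transverse array, which is a permutation array
    ([transverse_array_rank], [transverse_array_permutation]). Hence, if the
    array of the recurrence is not the transverse one, then
    [r(x; n) > max(0, n - sum_s (n - x_s))] at some position [x]. Fix such an
    [x]. A point [G] forces the subspaces [E^s_(x_s)] to meet in more than the
    expected dimension, so the flags for which these subspaces meet in at most
    the expected dimension have an empty Schubert intersection.

    It remains to see that this condition on the flags is open and dense. It
    says that a matrix with polynomial entries in representatives of the flags
    has large enough rank, i.e. that some minor is nonzero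
    ([transverse_at_open]); coordinate flags in cyclically shifted orders
    satisfy it ([transverse_at_nonempty]); and any nonempty open set is dense,
    because it contains the tuple of flags of the generic matrices, with
    entries in the field of rational functions
    ([generic_flags_in_open]). *)

(** * Flags of row vectors and matrices *)

(** With its converse [dim_kernel_ge], this translates dimensions of subspaces
    of row vectors into matrix ranks: if [W] is the left kernel of [M], then
    [\dim W] and [\rank M] add up to [n]. *)
Lemma dim_kernel_le (L : fieldType) n p (W : {vspace 'rV[L]_n})
    (M : 'M[L]_(n, p)) :
  (forall v, v \in W -> v *m M = 0) -> (\dim W + \rank M <= n)%N.
Proof.
move=> WM; pose A := \matrix_(i < \dim W) (vbasis W)`_i.
have combA v : v *m A = \sum_i v 0 i *: (vbasis W)`_i.
  by rewrite mulmx_sum_row; apply: eq_bigr => i _; rewrite rowK.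
have /eqP rankA : row_free A.
  apply: inj_row_free => v; rewrite combA.
  by have /freeP fW := basis_free (vbasisP W) => /fW v0;
    apply/rowP => i; rewrite v0 mxE.
rewrite -[X in (X + _)%N]rankA; apply: mulmx0_rank_max.
apply/row_matrixP => i; rewrite row_mul rowK row0; apply: WM.
by apply: vbasis_mem; apply: mem_nth; rewrite size_tuple.
Qed.

Lemma dim_kernel_ge (L : fieldType) n p (W : {vspace 'rV[L]_n})
    (M : 'M[L]_(n, p)) :
  (forall v, v *m M = 0 -> v \in W) -> (n <= \dim W + \rank M)%N.
Proof.
move=> MW; pose B := row_base (kermx M).
pose X := [tuple row i B | i < \rank (kermx M)].
have freeX : free X.
  apply/freeP => k sum0 i; pose u := \row_i k i.
  have u0 : u *m B = 0 *m B.
    rewrite mul0mx -[RHS]sum0 mulmx_sum_row.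
    by apply: eq_bigr => j _; rewrite mxE -tnth_nth tnth_mktuple.
  by have /rowP/(_ i) := row_free_inj (row_base_free _) u0; rewrite !mxE.
have XW : (<<X>> <= W)%VS.
  apply/span_subvP => _ /mapP[i _ ->]; apply: MW; apply/sub_kermxP.
  by rewrite (submx_trans (row_sub _ _)) // eq_row_base.
move: (dimvS XW); rewrite (eqP (freeX : _ == _)) size_tuple mxrank_ker.
by rewrite leq_subLR addnC.
Qed.

Definition row_span (L : fieldType) n (g : 'M[L]_n) i : {vspace 'rV[L]_n} :=
  <<[seq row a g | a : 'I_n <- enum 'I_n & (a < i)%N]>>%VS.

(** The coordinates of [v] in the basis of rows of [g] are the entries of
    [v *m invmx g]; this linear description of the spans is what makes
    conditions on intersections of flags polynomial in [g]. *)
Lemma mem_row_span (L : fieldType) n (g : 'M[L]_n) i (v : 'rV[L]_n) :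
  g \in unitmx ->
  v \in row_span g i <-> forall a : 'I_n, (i <= a)%N -> (v *m invmx g) 0 a = 0.
Proof.
move=> ug; split=> [vi a ia | v0].
  pose f := linfun (mulmxr (invmx g *m delta_mx a 0) : 'rV[L]_n -> 'rV[L]_1).
  have fE u : f u 0 0 = (u *m invmx g) 0 a.
    rewrite lfunE /= mulmxA [LHS]mxE (bigD1 a) //= big1 => [|b ba].
      by rewrite !mxE !eqxx mulr1 addr0.
    by rewrite [X in _ * X]mxE (negbTE ba) mulr0.
  have sub : (row_span g i <= lker f)%VS.
    apply/span_subvP => u /mapP[b]; rewrite mem_filter => /andP[bi _] ->.
    rewrite memv_ker; apply/eqP/matrixP => j k; rewrite !ord1 fE -row_mul.
    rewrite mulmxV // !mxE; case: eqP => // ba; move: ia; rewrite -ba.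
    by rewrite leqNgt bi.
  by have := subvP sub _ vi; rewrite memv_ker -fE => /eqP ->; rewrite mxE.
rewrite -(mulmxKV ug v) mulmx_sum_row; apply: rpred_sum => a _.
have [ai | ia] := ltnP a i; last by rewrite v0 // scale0r rpred0.
rewrite rpredZ // memv_span //; apply: map_f.
by rewrite mem_filter ai mem_enum.
Qed.

Lemma dim_row_span (L : fieldType) n (g : 'M[L]_n) i :
  g \in unitmx -> (i <= n)%N -> \dim (row_span g i) = i.
Proof.
move=> ug le_in; pose M := invmx g *m (copid_mx i : 'M_n).
have ME (v : 'rV_n) : v *m M = 0 <-> v \in row_span g i.
  rewrite mem_row_span // mulmxA; move: (v *m _) => u.
  have uE a : (u *m (copid_mx i : 'M_n)) 0 a = if (a < i)%N then 0 else u 0 a.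
    rewrite mulmxBr mulmx1 3!mxE [X in _ - X](bigD1 a) //= big1 => [|b ba].
      rewrite mxE eqxx /= addr0; case: ifP => _; rewrite ?mulr1 ?subrr //.
      by rewrite mulr0 subr0.
    by rewrite [X in _ * X]mxE (negbTE (ba : (b != a :> nat))) mulr0.
  split=> [/rowP u0 a ia | u0].
    by move: (u0 a); rewrite uE ltnNge ia mxE.
  by apply/rowP => a; rewrite uE mxE; case: ltnP => // /u0.
have rankM : \rank M = (n - i)%N.
  by rewrite eqmxMfull ?rank_copid_mx // row_full_unit unitmx_inv.
have := @dim_kernel_le _ _ _ (row_span g i) M (fun v => (ME v).2).
have := @dim_kernel_ge _ _ _ (row_span g i) M (fun v => (ME v).1).
rewrite rankM; lia.
Qed.

Lemma row_span_sub (L : fieldType) n (g : 'M[L]_n) i j :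
  (i <= j)%N -> (row_span g i <= row_span g j)%VS.
Proof.
move=> le_ij; apply: sub_span => u /mapP[a].
rewrite mem_filter => /andP[ai _] ->.
by apply: map_f; rewrite mem_filter (leq_trans ai) // mem_enum.
Qed.

Definition flag_of_matrix (L : fieldType) n (g : 'M[L]_n) (ug : g \in unitmx) :
    flag L n :=
  @Flag L n (fun i => row_span g i) (fun i => dim_row_span ug (ltn_ord i))
    (fun i j => @row_span_sub L n g i j).

Lemma flag_of_matrixP (L : fieldType) n (g : 'M[L]_n) (ug : g \in unitmx) :
  represents g (flag_of_matrix ug).
Proof. by split. Qed.

Lemma row_span_recr (L : fieldType) n (g : 'M[L]_n) (a : 'I_n) :
  (row_span g a + <[row a g]> <= row_span g a.+1)%VS.
Proof.
rewrite subv_add row_span_sub //= -memvE memv_span //; apply: map_f.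
by rewrite mem_filter ltnSn mem_enum.
Qed.

(** A basis adapted to [F]: its [a]-th vector is taken in a complement of the
    [a]-th step in the next one. *)
Lemma flag_represented (L : fieldType) n (F : flag L n) :
  exists g, represents g F.
Proof.
pose D (a : 'I_n) := (F (lift ord0 a) :\: F (widen_ord (leqnSn n) a))%VS.
pose g := \matrix_a vpick (D a).
have FS (i : 'I_n.+1) : (F i <= row_span g i)%VS.
  case: i => i; elim: i => [|i IHi] lt_in.
    have := flag_dim F (Ordinal lt_in) => /= /eqP; rewrite dimv_eq0 => /eqP ->.
    exact: sub0v.
  pose a : 'I_n := Ordinal (lt_in : (i < n)%N).
  apply: subv_trans (@row_span_recr _ _ g a).
  have aE : Ordinal lt_in = lift ord0 a by apply: val_inj.
  have bE : Ordinal (ltnW lt_in : (i < n.+1)%N) = widen_ord (leqnSn n) a.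
    by apply: val_inj.
  have dF := flag_dim F; rewrite aE.
  have sub : (F (widen_ord (leqnSn n) a) <= F (lift ord0 a))%VS.
    by apply: flag_sub; rewrite /= /bump /=.
  have dimD : \dim (D a) = 1%N.
    have := dimv_cap_compl (F (lift ord0 a)) (F (widen_ord (leqnSn n) a)).
    by rewrite (capv_idPr sub) !dF /= /bump /=; rewrite -/(D a); lia.
  have DE : D a = <[row a g]>%VS.
    rewrite rowK; apply/eqP; rewrite eq_sym eqEdim -memvE memv_pick dimD.
    by rewrite dim_vline vpick0 -dimv_eq0 dimD.
  have -> : F (lift ord0 a) = (F (widen_ord (leqnSn n) a) + D a)%VS.
    rewrite -(addv_diff_cap (F (lift ord0 a)) (F (widen_ord (leqnSn n) a))).
    by rewrite (capv_idPr sub) addvC.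
  rewrite -DE -bE; apply: addvS => //; exact: IHi.
have full : row_span g n = fullv.
  have Fmax : F ord_max = fullv.
    by apply/eqP; rewrite eqEdim subvf (flag_dim F) dimvf /dim /= mul1n.
  by apply/eqP; rewrite eqEsubv subvf -Fmax FS.
have ug : g \in unitmx.
  rewrite -row_full_unit -sub1mx; apply/row_subP => i.
  have: row i 1%:M \in row_span g n by rewrite full memvf.
  rewrite /row_span; set X := map _ _; rewrite -[X]/(in_tuple X : seq _).
  move/coord_span ->; apply: summx_sub => k _; apply: scalemx_sub.
  by have /mapP[a _ ->] := mem_nth 0 (ltn_ord k); exact: row_sub.
exists g; split=> // i; apply/eqP; rewrite -/(row_span g i) eqEdim FS.
have le_in : (i <= n)%N by rewrite -ltnS ltn_ord.
by rewrite dim_row_span // (flag_dim F) leqnn.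
Qed.

(** * Polynomial conditions and the generic point *)

(** Large rank is an open condition. *)
Lemma leq_rank_minor (L : fieldType) m n (M : 'M[L]_(m, n)) r :
  (r <= \rank M)%N <->
  exists f : {ffun 'I_r -> 'I_m}, exists h : {ffun 'I_r -> 'I_n},
    \det (mxsub f h M) != 0.
Proof.
split=> [le_r | [f [h]]]; last first.
  rewrite -unitfE -unitmxE -row_free_unit => /eqP <-.
  (* Passing to a submatrix does not increase the rank. *)
  rewrite mxsubrc (leq_trans (mxrankS (rowsub_sub _ _))) //.
  rewrite -mxrank_tr trmx_mxsub.
  by rewrite (leq_trans (mxrankS (rowsub_sub _ _))) ?mxrank_tr.
(* Keep the first [r] rows of a maximal independent set of rows; they stay
   independent because a right inverse restricts. *)
pose w := widen_ord le_r; pose B := rowsub (maxrankfun M) M.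
have /row_freeP[X BX] : row_free B := maxrowsub_free M.
have /eqP rankC : row_free (rowsub w B).
  apply/row_freeP; exists (colsub w X); rewrite -mxsub_mul BX.
  by apply/matrixP => i j; rewrite !mxE.
have fullC : row_full (rowsub w B)^T by rewrite /row_full mxrank_tr rankC.
exists [ffun i => maxrankfun M (w i)], (fullrankfun fullC).
set f := finfun _; set h := fullrankfun fullC.
have <- : (rowsub h (rowsub w B)^T)^T = mxsub f h M.
  by apply/matrixP => i j; rewrite !mxE [f i]ffunE.
by rewrite det_tr -unitfE -unitmxE fullrowsub_unit.
Qed.

Definition generic_matrix (K : fieldType) n d (s : 'I_d) :
    'M[matrix_poly K n d]_n :=
  \matrix_(a, b) 'X_(enum_rank (s, a, b)).

Section Evaluation.
Variables (K L : fieldType) (iota : {rmorphism K -> L}) (n d : nat).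
Variable g : 'I_d -> 'M[L]_n.

Let point (k : 'I_#|{: 'I_d * 'I_n * 'I_n}|) : L :=
  let: (s, a, b) := enum_val k in g s a b.

HB.instance Definition _ :=
  GRing.RMorphism.copy (eval_matrices iota g) (meval point \o map_mpoly iota).

Lemma eval_generic_matrix s :
  map_mx (eval_matrices iota g) (generic_matrix K n s) = g s.
Proof.
apply/matrixP => a b; rewrite !mxE /eval_matrices map_mpolyX mevalXU.
by rewrite enum_rankK.
Qed.

End Evaluation.

Section GenericPoint.
Variables (K : fieldType) (n d : nat).

Definition generic_field : fieldType := {fraction matrix_poly K n d}.

Definition generic_embedding : {rmorphism K -> generic_field} :=
  @tofrac _ \o @mpolyC #|{: 'I_d * 'I_n * 'I_n}| K.

Definition generic_point (s : 'I_d) : 'M[generic_field]_n :=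
  map_mx (@tofrac _) (generic_matrix K n s).

(** Over the field of rational functions in the matrix entries, evaluating a
    polynomial at the variables gives the polynomial back, so no nonzero
    polynomial vanishes at the generic point. *)
Lemma eval_generic_point (p : matrix_poly K n d) :
  eval_matrices generic_embedding generic_point p = tofrac p.
Proof.
elim/mpolyind: p => [|c m p _ _ IHp]; first by rewrite !rmorph0.
rewrite !rmorphD /= IHp; congr (_ + _).
rewrite -mul_mpolyC !rmorphM /= /eval_matrices map_mpolyC mevalC; congr (_ * _).
rewrite map_mpolyX mevalX mpolyXE_id rmorph_prod; apply: eq_bigr => k _.
rewrite rmorphXn /=; congr (_ ^+ _).
case def_k: (enum_val k) => [[s a] b].
by rewrite !mxE -def_k enum_valK.
Qed.

Lemma generic_point_unit s : generic_point s \in unitmx.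
Proof.
rewrite unitmxE unitfE det_map_mx tofrac_eq0; apply/eqP => det0.
pose g1 (_ : 'I_d) : 'M[K]_n := 1%:M.
suff: eval_matrices (idfun : {rmorphism K -> K}) g1
        (\det (generic_matrix K n s)) = 1.
  by rewrite det0 rmorph0 => /esym/eqP; rewrite oner_eq0.
by rewrite -det_map_mx eval_generic_matrix det1.
Qed.

Definition generic_flags (s : 'I_d) : flag generic_field n :=
  flag_of_matrix (generic_point_unit s).

Lemma generic_flags_in_open (V : flag_subset K n d) :
  zariski_open V -> (exists L iota E, V L iota E) ->
  V generic_field generic_embedding generic_flags.
Proof.
move=> [S VS] [L [iota [E VE]]].
have [g gE] : exists g : 'I_d -> 'M[L]_n, forall s, represents (g s) (E s).
  exact: (fin_all_exists (fun s => flag_represented (E s))).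
(* A polynomial that is nonzero at some point is a nonzero polynomial. *)
have [p Sp p_neq0] := (VS L iota E g gE).1 VE.
apply/(VS _ _ _ generic_point) => [s | ]; first exact: flag_of_matrixP.
exists p => //; rewrite eval_generic_point tofrac_eq0.
by apply: contraNneq p_neq0 => ->; rewrite rmorph0.
Qed.

Lemma zariski_open_dense (U : flag_subset K n d) :
  zariski_open U -> (exists L iota E, U L iota E) -> zariski_dense U.
Proof.
move=> openU U_neq0 V openV V_neq0.
exists generic_field, generic_embedding, generic_flags.
by split; apply: generic_flags_in_open.
Qed.

End GenericPoint.

(** * Flags that are transverse at a given position *)

Definition step n d (x : position n d) s : 'I_n.+1 := inord (x s).+1.

Lemma stepE n d (x : position n d) s : step x s = (x s).+1 :> nat.
Proof. by rewrite inordK // ltnS. Qed.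

(** The intersection of the steps of dimension [(x s).+1], the 1-based
    coordinates of [x]. *)
Definition meet_at (L : fieldType) n d (E : 'I_d -> flag L n)
    (x : position n d) : {vspace 'rV[L]_n} :=
  (\bigcap_s E s (step x s))%VS.

Definition codim_sum n d (x : position n d) : nat :=
  (\sum_s (n - (x s).+1))%N.

(** The columns of index at least [(x s).+1] of the adjugates, side by side:
    the left kernel is the intersection of the spans of the first [(x s).+1]
    rows of the [g s]. The adjugate replaces the inverse, from which it differs
    by a nonzero scalar, because its entries are polynomial in [g s]. *)
Definition incidence_mx (R : comNzRingType) n d (x : position n d)
    (g : 'I_d -> 'M[R]_n) : 'M[R]_(n, #|{: 'I_d * 'I_n}|) :=
  \matrix_(b < n, k < #|{: 'I_d * 'I_n}|) let: (s, a) := enum_val k in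
    if (x s < a)%N then \adj (g s) b a else 0.

Lemma map_incidence_mx (R S : comNzRingType) (f : {rmorphism R -> S}) n d
    (x : position n d) (g : 'I_d -> 'M[R]_n) :
  map_mx f (incidence_mx x g) = incidence_mx x (fun s => map_mx f (g s)).
Proof.
apply/matrixP => b k; rewrite !mxE; case: (enum_val k) => s a.
by case: ifP => _; rewrite ?rmorph0 // -map_mx_adj [RHS]mxE.
Qed.

Lemma mem_meet_at (L : fieldType) n d (E : 'I_d -> flag L n)
    (g : 'I_d -> 'M[L]_n) (x : position n d) v :
  (forall s, represents (g s) (E s)) ->
  v \in meet_at E x <-> v *m incidence_mx x g = 0.
Proof.
move=> gE; have entry s a : (v *m incidence_mx x g) 0 (enum_rank (s, a)) =
    if (x s < a)%N then \det (g s) * (v *m invmx (g s)) 0 a else 0.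
  rewrite mxE; case: ifP => lt_xa; last first.
    by apply: big1 => b _; rewrite mxE enum_rankK lt_xa mulr0.
  have [ug _] := gE s; rewrite /invmx ug -scalemxAr [X in _ * X]mxE mulrA.
  rewrite mulfV ?mul1r -?unitfE -?unitmxE // mxE.
  by apply: eq_bigr => b _; rewrite mxE enum_rankK lt_xa.
have memE s : v \in E s (step x s) <->
    forall a : 'I_n, (x s < a)%N -> (v *m invmx (g s)) 0 a = 0.
  have [ug Eg] := gE s; rewrite Eg -/(row_span (g s) (step x s)).
  by rewrite mem_row_span // stepE.
rewrite /meet_at; split=> [vE | v0].
  apply/rowP => k; rewrite -(enum_valK k); case: (enum_val k) => s a.
  rewrite entry [RHS]mxE; case: ifP => // lt_xa.
  rewrite ((memE s).1 _ a lt_xa) ?mulr0 //.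
  by move: vE; rewrite memvE => /subv_bigcapP/(_ s isT); rewrite -memvE.
rewrite memvE; apply/subv_bigcapP => s _; rewrite -memvE; apply/memE => a lt_xa.
have := entry s a; rewrite v0 lt_xa mxE => /esym/eqP; rewrite mulf_eq0.
have [ug _] := gE s; move: ug; rewrite unitmxE unitfE => /negbTE ->.
by move/eqP.
Qed.

(** Truncated subtraction makes the bound the expected dimension also when the
    codimensions add up to more than [n]. *)
Definition transverse_at (K : fieldType) n d (x : position n d) :
    flag_subset K n d :=
  fun L _ E => (\dim (meet_at E x) <= n - codim_sum x)%N.

(** The dimension of the intersection is [n] minus the rank of the incidence
    matrix, so the minors of order [min(n, codim_sum x)] cut out the
    complement. *)
Lemma transverse_at_open (K : fieldType) n d (x : position n d) :
  zariski_open (@transverse_at K n d x).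
Proof.
pose r := minn n (codim_sum x).
pose minor f h : matrix_poly K n d :=
  \det (@mxsub _ _ _ r r f h (incidence_mx x (generic_matrix K n (d := d)))).
exists (fun p => exists f : {ffun _}, exists h : {ffun _}, p = minor f h).
move=> L iota E g gE.
have minorE f h :
    eval_matrices iota g (minor f h) = \det (mxsub f h (incidence_mx x g)).
  rewrite -det_map_mx map_mxsub map_incidence_mx; congr (\det (mxsub _ _ _)).
  apply/matrixP => b k; rewrite !mxE; case: (enum_val k) => s a.
  by rewrite eval_generic_matrix.
have := @dim_kernel_le _ _ _ (meet_at E x) _ (fun v => (mem_meet_at x v gE).1).
have := @dim_kernel_ge _ _ _ (meet_at E x) _ (fun v => (mem_meet_at x v gE).2).
move=> ge_n le_n; have rankE : transverse_at x iota E <->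
    (r <= \rank (incidence_mx x g))%N.
  by rewrite /transverse_at /r; lia.
apply: (iff_trans rankE); apply: (iff_trans (leq_rank_minor _ _)).
split=> [[f [h fh]] | [_ [f [h ->]] fh]].
  by exists (minor f h); [exists f, h | rewrite minorE].
by exists f, h; rewrite -minorE.
Qed.

Lemma partial_sum_between d (F : 'I_d -> nat) k :
  (k < \sum_s F s)%N ->
  exists s : 'I_d, (\sum_(t < d | t < s) F t <= k
                    < \sum_(t < d | t < s) F t + F s)%N.
Proof.
pose C i := (\sum_(t < d | t < i) F t)%N => lt_k.
have Cd : (k < C d)%N.
  by rewrite /C; under eq_bigl => t do rewrite ltn_ord.
case: (ex_minnP (ex_intro (fun i => k < C i)%N d Cd)) => [[|i]].
  by rewrite /C big_pred0.
move=> ltCi minC; have lt_id : (i < d)%N by exact: minC.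
exists (Ordinal lt_id); apply/andP; split=> /=.
  by rewrite leqNgt; apply/negP => /minC; rewrite ltnn.
apply: leq_trans ltCi _; rewrite /C (bigD1 (Ordinal lt_id)) //= addnC leq_add2r.
rewrite (eq_bigl (fun t : 'I_d => t < i)%N) // => t.
by rewrite -val_eqE /= ltnS ltn_neqAle andbC.
Qed.

Definition shift_fun n c (a : 'I_n) : 'I_n :=
  Ordinal (ltn_pmod (a + c) (leq_ltn_trans (leq0n a) (ltn_ord a))).

Lemma shift_fun_inj n c : injective (@shift_fun n c).
Proof.
move=> a b /(congr1 val) /= /eqP; rewrite eqn_modDr !modn_small // => /eqP.
exact: val_inj.
Qed.

Definition shift_perm n c : 'S_n := perm (@shift_fun_inj n c).

(** Cut the integers below [codim_sum x] into consecutive intervals of lengths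
    [n - (x s).+1], read modulo [n]. The [s]-th flag is the coordinate flag in
    the cyclic order that ends with the [s]-th interval, so its step of
    dimension [(x s).+1] is where the coordinates of that interval vanish.
    Together the intervals cover every coordinate below [codim_sum x]. *)
Lemma transverse_at_nonempty (K : fieldType) n d (x : position n d) :
  exists L iota E, @transverse_at K n d x L iota E.
Proof.
pose e s := (n - (x s).+1)%N.
pose C (s : 'I_d) := (\sum_(t < d | t < s) e t + e s)%N.
pose g s : 'M[K]_n := perm_mx (shift_perm n (C s)).
have ug s : g s \in unitmx := unitmx_perm _ _.
exists K, idfun, (fun s => flag_of_matrix (ug s)).
rewrite /transverse_at; set W := meet_at _ x.
have W0 (v : 'rV_n) (k : 'I_n) : v \in W -> (k < codim_sum x)%N -> v 0 k = 0.
  rewrite memvE => /subv_bigcapP vW.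
  move=> /(@partial_sum_between _ e)[s /andP[ge_k lt_k]].
  have := vW s isT; rewrite -memvE => /(mem_row_span _ _ (ug s)) vs.
  (* The index bounded here is the place of the [k]-th standard vector in the
     [s]-th basis; it lies beyond the step of dimension [(x s).+1]. *)
  have lt_an : (k - \sum_(t < d | t < s) e t + (x s).+1 < n)%N.
    have es : e s = (n - (x s).+1)%N by [].
    by have := ltn_ord (x s); lia.
  have := vs (Ordinal lt_an); rewrite stepE leq_addl => /(_ isT).
  move: (v *m _) (mulmxKV (ug s) v) => u <-.
  rewrite /g -[shift_perm _ _]invgK -col_permE mxE => <-; congr (u 0 _).
  apply: (canLR (permK _)); apply: val_inj; rewrite permE /=.
  have -> : (k - \sum_(t < d | t < s) e t + (x s).+1 + C s = n + k)%N.
    have es : e s = (n - (x s).+1)%N by [].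
    by have := ltn_ord (x s); rewrite /C; lia.
  by rewrite modnDl modn_small.
pose r := minn n (codim_sum x).
have := @dim_kernel_le _ _ _ W (pid_mx r : 'M_n).
rewrite rank_pid_mx ?geq_minl //.
have Wr v : v \in W -> v *m (pid_mx r : 'M_n) = 0.
  move=> vW; apply/rowP => k; rewrite !mxE big1 // => i _; rewrite mxE.
  case: eqP => [ik | _]; last by rewrite mulr0.
  have [lt_ir | _] := ltnP i r; last by rewrite mulr0.
  by rewrite W0 ?mul0r // (leq_trans lt_ir) ?geq_minr.
by move/(_ Wr); rewrite /r; lia.
Qed.

(** * Bounds from the recurrence *)

(** The first [i] rows of a permutation matrix are independent. *)
Lemma corner_rank_full n (w : 'S_n) i : (i <= n)%N -> corner_rank w i n = i.
Proof.
move=> le_in; have inj_c : injective (fun c => w (rev_ord c)).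
  by move=> b c /perm_inj/rev_ord_inj.
have SE : schubert_mx w = (perm_mx (perm inj_c))^T.
  by apply/matrixP => a c; rewrite !mxE permE eq_sym.
rewrite /corner_rank pid_mx_1 mulmx1 mxrankMfree ?rank_pid_mx //.
by rewrite SE row_free_unit unitmx_tr unitmx_perm.
Qed.

Section RecurrenceBounds.
Variables (n d : nat) (w : 'I_d -> 'S_n) (x : position n d).

Lemma rec_value_cons s l j : l != [::] -> (0 < j)%N ->
  rec_value w x (s :: l) j =
  Num.max ((corner_rank (w s) (x s).+1 j)%:Z + rec_value w x l j - j%:Z)
    (rec_value w x (s :: l) j.-1).
Proof. by case: l j => [|t l] [|j]. Qed.

Lemma rec_value_ge0 l j : 0 <= rec_value w x l j.
Proof.
case: l => [|s [|t l]] //; elim: j => [|j IHj] //.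
by rewrite rec_value_cons // le_max IHj orbT.
Qed.

(** The first branch of the recurrence at [j = n] loses [n - (x s).+1] for each
    index, and the second one keeps the values nonnegative. *)
Lemma rec_value_ge l :
  (n - \sum_(s <- l) (n - (x s).+1))%:Z <= rec_value w x l n.
Proof.
elim: l => [|s l IHl]; first by rewrite big_nil subn0.
rewrite big_cons; have lt_xn := ltn_ord (x s).
have [-> | l_neq0] := eqVneq l [::].
  by rewrite big_nil /= corner_rank_full //; lia.
have recE : rec_value w x (s :: l) n =
  Num.max ((x s).+1%:Z + rec_value w x l n - n%:Z)
    (rec_value w x (s :: l) n.-1).
  by rewrite rec_value_cons ?corner_rank_full //; lia.
have := rec_value_ge0 (s :: l) n.-1.
have : (x s).+1%:Z + rec_value w x l n - n%:Z <= rec_value w x (s :: l) n.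
  by rewrite recE le_max lexx.
have : rec_value w x (s :: l) n.-1 <= rec_value w x (s :: l) n.
  by rewrite recE le_max lexx orbT.
move: IHl; lia.
Qed.

Variables (L : fieldType) (E : 'I_d -> flag L n) (G : flag L n).

(** The first branch of the recurrence is the dimension formula for two
    subspaces of [G j], the second one is the inclusion of [G (j - 1)] in
    [G j]. *)
Lemma rec_value_le_dim l (j : 'I_n.+1) :
  schubert_intersection w E G ->
  rec_value w x l j <= (\dim ((\bigcap_(s <- l) E s (step x s)) :&: G j)%VS)%:Z.
Proof.
move=> EG; have cornerP s (i : 'I_n.+1) :
    (corner_rank (w s) (x s).+1 i <= \dim (E s (step x s) :&: G i)%VS)%N.
  by have := EG s (step x s) i; rewrite stepE.
elim: l j => [|s l IHl] j; first by rewrite big_nil capfv (flag_dim G) lexx.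
have [-> | l_neq0] := eqVneq l [::].
  by rewrite big_seq1 /= lez_nat cornerP.
rewrite big_cons; set V := (\bigcap_(t <- l) _)%VS in IHl *.
case: j => j; elim: j => [|j IHj] lt_jn; first by case: (l) l_neq0.
rewrite rec_value_cons // ge_max; apply/andP; split; last first.
  apply: (le_trans (IHj (ltnW lt_jn))); rewrite lez_nat; apply: dimvS.
  by apply: capvS => //; apply: flag_sub => /=.
have := IHl (Ordinal lt_jn); have := cornerP s (Ordinal lt_jn).
set A := E s _; set Gj := G _.
have := dimv_sum_cap (A :&: Gj)%VS (V :&: Gj)%VS.
have -> : ((A :&: Gj) :&: (V :&: Gj) = A :&: V :&: Gj)%VS.
  by rewrite (capvC V) -!capvA (capvA Gj) capvv (capvC Gj).
have : (\dim (A :&: Gj + V :&: Gj)%VS <= j.+1)%N.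
  have <- : \dim Gj = j.+1 := flag_dim G _.
  by apply: dimvS; rewrite subv_add !capvSr.
by rewrite /=; lia.
Qed.

Lemma rec_table_le_dim :
  schubert_intersection w E G -> rec_table w x n <= (\dim (meet_at E x))%:Z.
Proof.
move=> EG; have := rec_value_le_dim [seq s <- enum 'I_d | ((x s).+1 < n)%N]
  ord_max EG.
have Gmax : G ord_max = fullv.
  by apply/eqP; rewrite eqEdim subvf (flag_dim G) dimvf /dim /= mul1n.
rewrite Gmax capvf /rec_table /meet_at => /le_trans; apply.
rewrite lez_nat; apply: dimvS; apply/subv_bigcapP => s _.
rewrite big_filter big_enum_cond /=.
have [lt_xn | ge_xn] := ltnP (x s).+1 n.
  by apply: bigcapv_inf lt_xn _.
(* Indices with [(x s).+1 = n] are skipped by the recurrence; their subspaces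
   are the whole space. *)
suff -> : E s (step x s) = fullv by exact: subvf.
apply/eqP; rewrite eqEdim subvf (flag_dim (E s)) dimvf /dim /= mul1n stepE.
exact: ge_xn.
Qed.

Lemma rec_table_ge : (n - codim_sum x)%:Z <= rec_table w x n.
Proof.
apply: le_trans (rec_value_ge _); rewrite lez_nat leq_sub2l //.
rewrite big_filter big_enum_cond /= /codim_sum.
by rewrite [leqRHS](bigID (fun s => (x s).+1 < n)%N) leq_addr.
Qed.

End RecurrenceBounds.

(** * The transverse permutation array *)

Lemma mem_transverse_array n d (x : position n d) :
  (0 < d)%N -> (x \in transverse_array n d) = (codim_sum x + 1 == n)%N.
Proof.
move=> d_gt0; have sumE : (\sum_i (x i).+1 + codim_sum x = d * n)%N.
  rewrite /codim_sum -big_split /= -[in RHS](card_ord d) -sum_nat_const.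
  by apply: eq_bigr => i _; rewrite subnKC.
rewrite inE; lia.
Qed.

Lemma card_ord_between n a b :
  (b < n)%N -> #|[set k : 'I_n | a <= k <= b]%N| = (b.+1 - a)%N.
Proof.
move=> lt_bn; rewrite -sum1_card.
under eq_bigl => k do rewrite inE.
rewrite -(big_mkord (fun k => a <= k <= b)%N (fun=> 1%N)).
rewrite -[RHS]muln1 -sum_nat_const_nat (big_nat_widen a b.+1 n) //.
by rewrite (big_nat_widenl a 0) //; apply: eq_bigl => k; rewrite ltnS andbC.
Qed.

(** Let [R] be the sum of the codimensions of [y] other than the [j]-th. A
    position of the transverse array has codimensions with sum [n - 1], and it
    lies below [y] when they are at least those of [y]; so its [j]-th
    coordinate is at least [R] and at most [y j]. Conversely each such value
    occurs: a second index can absorb the slack. *)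
Lemma transverse_array_rank n d (y : position n d) :
  (1 < d)%N -> has_rank (principal (transverse_array n d) y) (n - codim_sum y).
Proof.
move=> d_gt1 j; have d_gt0 := ltnW d_gt1.
pose e (x : position n d) (i : 'I_d) : nat := (n - (x i).+1)%N.
pose R := (\sum_(i | i != j) e y i)%N.
have codimE (x : position n d) :
    codim_sum x = (e x j + \sum_(i | i != j) e x i)%N.
  by rewrite /codim_sum (bigD1 j).
have eE (x : position n d) i : (e x i + (x i).+1 = n)%N by rewrite subnK.
have -> : (n - codim_sum y = (y j).+1 - R)%N.
  by have := eE y j; rewrite codimE -/R; lia.
rewrite -(card_ord_between R (ltn_ord (y j))) /rk_coord; congr #|pred_of_set _|.
apply/setP => k; rewrite !inE; apply/exists_inP/andP => [[x] | [le_Rk le_ky]].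
  rewrite inE mem_transverse_array // codimE => /andP[/eqP xT /forallP le_xy].
  move/eqP <-; rewrite le_xy; split=> //.
  rewrite -ltnS -(ltn_add2l (e x j)) eE -[X in (_ < X)%N]xT addn1 ltnS.
  by rewrite leq_add2l; apply: leq_sum => i _; rewrite leq_sub2l // ltnS.
have [i0 i0j] : exists i0 : 'I_d, i0 != j.
  have [j0 | j_gt0] := posnP j.
    by exists (Ordinal d_gt1); rewrite -val_eqE /= j0.
  by exists (Ordinal d_gt0); rewrite -val_eqE /= eq_sym -lt0n.
(* [k - R'] is the codimension left for [i0] when the other coordinates are
   those of [y]. *)
pose R' := (\sum_(i | (i != j) && (i != i0)) e y i)%N.
have RE : R = (e y i0 + R')%N by rewrite /R (bigD1 i0).
have lt_xn : (n - (k - R').+1 < n)%N by have := ltn_ord k; lia.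
pose x : position n d :=
  [ffun i => if i == j then k else if i == i0 then Ordinal lt_xn else y i].
have xj : x j = k by rewrite ffunE eqxx.
have xi0 : x i0 = Ordinal lt_xn by rewrite ffunE (negbTE i0j) eqxx.
have xi i : i != j -> i != i0 -> x i = y i.
  by move=> ij ii0; rewrite ffunE (negbTE ij) (negbTE ii0).
exists x; last by rewrite xj.
rewrite inE mem_transverse_array // codimE (bigD1 i0) //=.
have -> : (\sum_(i | (i != j) && (i != i0)) e x i = R')%N.
  by apply: eq_bigr => i /andP[ij ii0]; rewrite /e xi.
have := eE y i0; have := eE x i0; have := eE x j.
rewrite xj xi0 /= => xjE xi0E yE.
have lt_kn := ltn_ord k; apply/andP; split; first by apply/eqP; lia.
apply/forallP => i; have [-> | ij] := eqVneq i j; first by rewrite xj.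
have [-> | ii0] := eqVneq i i0; last by rewrite xi.
by rewrite xi0 /=; lia.
Qed.

(** The array is an antichain: its positions have the same coordinate sum, so
    anything in it below [x] equals [x], and a join of two distinct elements
    leaves the array. *)
Lemma transverse_array_irredundant n d (x : position n d) :
  (0 < d)%N -> x \in transverse_array n d ->
  ~ redundant (transverse_array n d) x.
Proof.
move=> d_gt0 xT [R [RT joinR R_gt1 _]].
suff: R \subset [set x] by move/subset_leq_card; rewrite cards1 leqNgt R_gt1.
apply/subsetP => y yR; rewrite inE; have yT := subsetP RT y yR.
have le_yx i : (y i <= x i)%N.
  by rewrite joinR (bigD1 y) //= leq_maxl.
have sumE : (\sum_i (y i).+1 = \sum_i (x i).+1)%N.
  apply/eqP; rewrite -(eqn_add2r n); move: xT yT; rewrite !inE.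
  by move=> /eqP -> /eqP ->.
have le_yxS i : true -> ((y i).+1 <= (x i).+1 ?= iff ((y i).+1 == (x i).+1))%N.
  by move=> _; apply: leqif_eq; rewrite ltnS.
have [_] := leqif_sum le_yxS; rewrite sumE eqxx => /esym.
move/forall_inP => yx; apply/eqP/ffunP => i; apply: val_inj.
by have /eqP[] := yx i isT.
Qed.

(** The full rank is the rank at the largest position, which exists unless
    [n = 0]. *)
Lemma transverse_array_permutation n d :
  (1 < d)%N -> permutation_array (transverse_array n d).
Proof.
move=> d_gt1; split=> [y | | x].
- by exists (n - codim_sum y)%N; apply: transverse_array_rank.
- have [n0 | n_gt0] := posnP n.
    move=> j; have : (rk_coord (transverse_array n d) j <= n)%N.
      by rewrite -[X in (_ <= X)%N](card_ord n) max_card.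
    by lia.
  have lt_pn : (n.-1 < n)%N by rewrite prednK.
  pose top : position n d := [ffun=> Ordinal lt_pn].
  have codim0 : codim_sum top = 0%N.
    by apply: big1 => i _; rewrite ffunE /= prednK // subnn.
  have topE : principal (transverse_array n d) top = transverse_array n d.
    apply/setP => x; rewrite inE andb_idr // => _; apply/forallP => i.
    by rewrite ffunE /= -ltnS prednK.
  by have := transverse_array_rank top d_gt1; rewrite codim0 subn0 topE.
- by apply: transverse_array_irredundant; apply: ltnW.
Qed.

(** * Emptiness of the intersection *)

Theorem corollary5p2 (K : fieldType) (n d : nat) (w : 'I_d -> 'S_n)
    (hd : (1 < d)%N)
    (hlen : (\sum_(s < d) inversions (w s))%N = 'C(n, 2))
    (hP : ~ is_schubert_array w (transverse_array n d)) :
  for_general_flags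
    (fun (L : fieldType) (iota : {rmorphism K -> L}) (E : 'I_d -> flag L n) =>
       forall G : flag L n, ~ schubert_intersection w E G).
Proof.
(* By [rec_table_ge], the recurrence exceeds the transverse rank at [x]. *)
have [x xP] : exists x, rec_table w x n != (n - codim_sum x)%:Z.
  apply/existsP; apply: contra_notT hP => /existsPn tableE.
  split; first exact: transverse_array_permutation.
  move=> x; exists (n - codim_sum x)%N; first exact: transverse_array_rank.
  by apply/eqP; rewrite -[_ == _]negbK tableE.
exists (@transverse_at K n d x); split.
- exact: transverse_at_open.
- by apply: zariski_open_dense; [apply: transverse_at_open
                                | apply: transverse_at_nonempty].
move=> L iota E dimE G EG; move/eqP: xP; apply.
apply/eqP; rewrite eq_le rec_table_ge andbT.
by rewrite (le_trans (rec_table_le_dim x EG)) // lez_nat.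
Qed.
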